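(* Let $U$ be a unicyclic bipartite graph with a unique perfect matching, let $2m$ be the length of its cycle and $2k$ the number of matched edges incident to (and not in) the cycle, and let $D$ be the associated digraph of $U$. Then $D$ is invertible if and only if either $m+k$ is even, or $k=1$ and the two matched edges incident to the cycle are incident to adjacent vertices of the cycle.
   Context: Graphs are finite, may have multiple edges between distinct vertices, and have no loops. A graph is unicyclic if it contains exactly one cycle. A perfect matching is a set of edges covering each vertex exactly once; its edges are called matched edges. A matched edge is ''incident to (and not in) the cycle'' if it is not an edge of the cycle but has an endpoint on the cycle. For a unicyclic bipartite graph with a unique perfect matching the cycle has even length and the number of such matched edges is even, so $m$ and $k$ are integers. Associated digraph: let $U$ be bipartite on $2n$ vertices with a unique perfect matching. Its vertices can be labelled $1,\dots,2n$ so that the matching consists of the edges $\{i,n+i\}$, $1\le i\le n$, $\{1,\dots,n\}$ and $\{n+1,\dots,2n\}$ are the two colour classes, and every non-matching edge joins some $i$ to some $n+j$ with $1\le i<j\le n$. The associated digraph $D$ has vertex set $\{1,\dots,n\}$ and one edge $i\to j$ for each edge of $U$ joining $i$ and $n+j$ ($i\ne j$). Let $B$ be the $n\times n$ upper unitriangular matrix with $B_{i,i}=1$ and $B_{i,j}$ the number of edges $i\to j$ of $D$ for $i\ne j$. $D$ is invertible if there is a diagonal matrix $S$ with diagonal entries in $\{\pm1\}$ such that $SB^{-1}S=|B^{-1}|$, where $|\cdot|$ is the componentwise absolute value. *)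

(* Defs.v *)
From HB Require Import structures.
From mathcomp Require Import all_boot all_order all_algebra.

Set Implicit Arguments.
Unset Strict Implicit.
Unset Printing Implicit Defensive.

Import Order.TTheory GRing.Theory Num.Theory.

(* Finite graphs with possible multiple edges (edges have their own identity)
   and no loops (every edge has two distinct ends). *)
Record multigraph := Multigraph {
  vertex : finType;
  edge : finType;
  ends : edge -> {set vertex};
  ends_card : forall e : edge, #|ends e| = 2
}.

Definition covered (U : multigraph) (A : {set edge U}) : {set vertex U} :=
  \bigcup_(e in A) ends e.

(* A cycle is identified with its edge set; two parallel edges form a cycle of
   length 2. [ordS] is the cyclic successor on ['I_l]. *)
Definition is_cycle (U : multigraph) (C : {set edge U}) : Prop :=
  exists l (v : 'I_l -> vertex U) (e : 'I_l -> edge U),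
    [/\ 1 < l, injective v, injective e,
        forall i, ends (e i) = [set v i; v (ordS i)]
      & C = [set e i | i : 'I_l]].

Definition unicyclic (U : multigraph) : Prop :=
  exists! C : {set edge U}, is_cycle C.

Definition bipartite (U : multigraph) : Prop :=
  exists A : {set vertex U}, forall e : edge U, #|ends e :&: A| = 1.

Definition perfect_matching (U : multigraph) (M : {set edge U}) : Prop :=
  forall v : vertex U, #|[set e in M | v \in ends e]| = 1.

Definition has_unique_perfect_matching (U : multigraph) : Prop :=
  exists! M : {set edge U}, perfect_matching M.

Definition incident_matched (U : multigraph) (M C : {set edge U}) :
    {set edge U} :=
  [set e in M | (e \notin C) && [exists v in ends e, v \in covered C]].

Definition at_adjacent_cycle_vertices (U : multigraph) (C : {set edge U})
    (e1 e2 : edge U) : Prop :=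
  exists v1 v2 : vertex U,
    [/\ v1 \in ends e1, v2 \in ends e2
      & exists2 f, f \in C & ends f = [set v1; v2]].

(* The pair {i, n+j}, the labels 1..n being [lshift n i] and the labels
   n+1..2n being [rshift n j]. *)
Definition lab_pair (U : multigraph) (n : nat) (lab : 'I_(n + n) -> vertex U)
    (i j : 'I_n) : {set vertex U} :=
  [set lab (lshift n i); lab (rshift n j)].

Definition admissible_labelling (U : multigraph) (M : {set edge U}) (n : nat)
    (lab : 'I_(n + n) -> vertex U) : Prop :=
  [/\ bijective lab,
      M = [set e | [exists i, ends e == lab_pair lab i i]],
      forall e : edge U, exists i j, ends e = lab_pair lab i j
    & forall e : edge U, e \notin M ->
        exists i j : 'I_n, i < j /\ ends e = lab_pair lab i j].

Record multidigraph (n : nat) := Multidigraph {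
  arc : finType;
  source : arc -> 'I_n;
  target : arc -> 'I_n
}.

(* An arc i -> j is an edge of U together with the (unique) indices i != j
   such that it joins i and n+j. *)
Definition associated_digraph (U : multigraph) (n : nat)
    (lab : 'I_(n + n) -> vertex U) : multidigraph n :=
  @Multidigraph n
    {t : edge U * ('I_n * 'I_n) |
       (t.2.1 != t.2.2) && (ends t.1 == lab_pair lab t.2.1 t.2.2)}
    (fun a => (val a).2.1) (fun a => (val a).2.2).

Definition digraph_mx (n : nat) (D : multidigraph n) : 'M[int]_n :=
  (\matrix_(i, j)
    if i == j then 1
    else #|[set a : arc D | (source a == i) && (target a == j)]|%:R)%R.

(* [digraph_mx D] is upper unitriangular for the digraphs considered, hence
   invertible over the integers. *)
Definition digraph_invertible (n : nat) (D : multidigraph n) : Prop :=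
  let Binv := invmx (digraph_mx D) in
  exists s : 'rV[int]_n,
    (forall i, s ord0 i = 1 \/ s ord0 i = -1)%R
    /\ (diag_mx s *m Binv *m diag_mx s = map_mx Num.norm Binv)%R.

(* Main.v *)
Require Import Defs.
From mathcomp Require Import all_boot all_order all_algebra.
From mathcomp Require Import zify.

(** Write B for the matrix of D and X for its inverse. Reading B X = 1 row by
row gives X_ij = [i = j] - sum_(l > i) B_il X_lj, so X_ij is the sum of
(-1)^length over the directed paths from i to j. Conjugating B by a sign
matrix S and inverting commute, so D is invertible as soon as signs can be
chosen with opposite values at the two ends of every arc: S B S then has
non-positive off-diagonal entries, hence a non-negative inverse.

Contracting the matching turns the cycle C of U, of length 2m, into a closed
walk with 2m - a arcs, where a is the number of matched edges on C. A matched
edge off the cycle has at most one end on the cycle (two would produce a second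
cycle), so 2m = 2k + 2a and m + k has the parity of a. Since U minus a cycle
edge f is a forest, signs alternating along all arcs other than f always exist,
and the arc f obeys the rule too exactly when a is even
([cycle_potential]). This settles the even case ([even_invertible]).

Let a be odd. In any choice of signs, some arc f : p -> q on the cycle then
joins equal signs, as each cycle vertex lies on two cycle edges
([cycle_parity]).

If D is invertible with these signs, then X_pq >= 0, which forces a second
directed path from p to q. Together with f it makes a cycle of U, which has to
be C. Along a directed path of D, all left vertices except the first are
matched along the path, so C contains all the matched edges at its vertices
except those at the ends of f: this is the case k = 1 with adjacent ends
([invertible_shortcut]).

Conversely, if the matched edges missing from C are those at the ends of
f : p -> q, take signs alternating along all arcs but f. Then S B S = B0 + E_pq,
where B0 has non-positive off-diagonal entries and an inverse Y >= 0. As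
E Y E = 0, the inverse of S B S is Y - Y E_pq Y, with entries
Y_ij - Y_ip Y_qj. Concatenation of paths gives Y_ij >= Y_ip Y_pq Y_qj, and
Y_pq >= 1 because the rest of C is a directed path from p to q
([invmx_ge0_cancel], [shortcut_invertible]).

The order of the vertices around C is never needed in these two arguments:
counting the edges of C at its vertices suffices. *)

Set Implicit Arguments.
Unset Strict Implicit.
Unset Printing Implicit Defensive.

Import Order.TTheory GRing.Theory Num.Theory.

(** * Cycles and potentials in multigraphs *)

Definition adj (U : multigraph) (A : {set edge U}) : rel (vertex U) :=
  fun x y => [exists e in A, ends e == [set x; y]].

Lemma adjI (U : multigraph) (A : {set edge U}) e x y :
  e \in A -> ends e = [set x; y] -> adj A x y.
Proof. by move=> eA ee; apply/existsP; exists e; rewrite eA ee eqxx. Qed.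

Lemma adj_sym (U : multigraph) (A : {set edge U}) : symmetric (adj A).
Proof. by move=> x y; rewrite /adj; under eq_existsb do rewrite setUC. Qed.

Lemma ends_neq (U : multigraph) (e : edge U) x y :
  ends e = [set x; y] -> x != y.
Proof.
by move=> ee; have := ends_card e; rewrite ee cards2; case: (x != y).
Qed.

(** The only source of new cycles: a shortest walk in [A] between the ends of
an edge outside [A], closed up by that edge. *)
Lemma cycle_through (U : multigraph) (A : {set edge U}) f x y :
    ends f = [set x; y] -> f \notin A -> connect (adj A) x y ->
  exists C, [/\ is_cycle C, f \in C & C \subset f |: A].
Proof.
move=> ef fA /connectP[p0 p0P y0]; have xy := ends_neq ef.
move: y0; case/shortenP: p0P => p pP up _ yE.
pose s := x :: p; pose l := size s.
have l1 : 1 < l by rewrite /l /s; case: (p) yE xy => //= ->; rewrite eqxx.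
have yn : y = nth x s l.-1 by rewrite yE /l /s /= nth_last.
pose v (i : 'I_l) := nth x s i.
have pk (i : nat) : i.+1 < l ->
    exists e, (e \in A) && (ends e == [set nth x s i; nth x s i.+1]).
  move=> il; have /existsP[e eP] : adj A (nth x s i) (nth x s i.+1).
    exact: (pathP x pP).
  by exists e.
(* The closing edge [f] sits at the last index, where [ordS] wraps around. *)
have [e eP] : exists e : 'I_l -> edge U, forall i : 'I_l,
    if i.+1 < l
    then (e i \in A) && (ends (e i) == [set nth x s i; nth x s i.+1])
    else e i == f.
  pose P (i : 'I_l) (e : edge U) := if i.+1 < l
    then (e \in A) && (ends e == [set nth x s i; nth x s i.+1]) else e == f.
  apply: (@fin_all_exists _ (fun=> edge U) P) => i; rewrite /P.
  by case il: (i.+1 < l); [exact: pk|exists f].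
have vi : injective v.
  by move=> i j /eqP; rewrite nth_uniq // => /eqP/val_inj.
have last_i (i : 'I_l) : ~~ (i.+1 < l) -> i = l.-1 :> nat.
  by have := ltn_ord i; lia.
have ends_e i : ends (e i) = [set v i; v (ordS i)].
  have := eP i; rewrite /v /=; case: ltnP => il.
    by rewrite modn_small // => /andP[_ /eqP].
  move=> /eqP ->; rewrite ef setUC yn; have li := last_i i.
  rewrite -li -?leqNgt //.
  suff -> : i.+1 = l by rewrite modnn.
  by have := ltn_ord i; lia.
exists [set e i | i : 'I_l]; split.
- exists l, v, e; split=> // i j eij.
  have := eP i; have := eP j; rewrite eij.
  case: ltnP => jl; case: ltnP => il.
  + move=> /andP[_ /eqP->] /andP[_ /eqP ee].
    have iv : nth x s i \in [set nth x s j; nth x s j.+1].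
      by rewrite ee !inE eqxx.
    have jv : nth x s j \in [set nth x s i; nth x s i.+1].
      by rewrite -ee !inE eqxx.
    move: iv jv; rewrite !inE !nth_uniq //; try (by rewrite /s /=; lia).
    by move=> h1 h2; apply: val_inj => /=; lia.
  + by move=> /andP[eA _] /eqP ejf; rewrite ejf (negPf fA) in eA.
  + by move=> /eqP-> /andP[eA _]; rewrite (negPf fA) in eA.
  + move=> _ _; apply: val_inj => /=.
    by have := ltn_ord i; have := ltn_ord j; lia.
- have ll : l.-1 < l by lia.
  apply/imsetP; exists (Ordinal ll) => //; have := eP (Ordinal ll).
  by case: ltnP => [h _|_ /eqP//]; have : l.-1.+1 < l := h; lia.
- apply/subsetP=> _ /imsetP[i _ ->]; rewrite !inE; have := eP i.
  by case: ifP => _ => [/andP[->]|/eqP->]; rewrite ?orbT ?eqxx.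
Qed.

(** The two edges of the cycle at its vertex number i are those numbered i and
i - 1; they differ even when the cycle has length 2. *)
Lemma cycle_degree (U : multigraph) (C : {set edge U}) x :
  is_cycle C -> #|[set e in C | x \in ends e]| = 2 * (x \in covered C).
Proof.
case=> l [v [e [l1 vi ei ends_e ->]]].
have [|nx] := boolP (x \in _); last first.
  rewrite muln0; apply: eq_card0 => f; rewrite !inE; apply/negbTE/negP.
  by case/andP=> fC xf; case/negP: nx; apply/bigcupP; exists f.
case/bigcupP=> _ /imsetP[i0 _ ->]; rewrite ends_e => xi.
have [i ->] : exists i, x = v i.
  by case/set2P: xi => ->; [exists i0|exists (ordS i0)].
rewrite muln1; have -> : [set f in [set e i | i : 'I_l] | v i \in ends f] =
   [set e i; e (ord_pred i)].
  apply/setP=> f; rewrite !inE; apply/andP/orP.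
    case=> /imsetP[j _ ->]; rewrite ends_e !inE !(inj_eq vi) (inj_eq ei).
    rewrite (inj_eq ei); case/orP=> /eqP->; first by left.
    by right; rewrite ordSK.
  case=> /eqP->; split; try exact: imset_f; rewrite ends_e !inE ?eqxx //.
  by rewrite ord_predK eqxx orbT.
rewrite cards2 (inj_eq ei); suff -> : i != ord_pred i by [].
apply/eqP=> /(congr1 (@ordS _)); rewrite ord_predK => /(congr1 val) /=.
have il0 := ltn_ord i; have [il|il] : i.+1 = l \/ i.+1 < l by lia.
  by rewrite il modnn; lia.
by rewrite modn_small //; lia.
Qed.

Lemma cycle_connected (U : multigraph) (C : {set edge U}) x y :
  is_cycle C -> x \in covered C -> y \in covered C -> connect (adj C) x y.
Proof.
case=> l [v [e [l1 vi ei ends_e CE]]].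
have cv z : z \in covered C -> exists i, z = v i.
  case/bigcupP=> f; rewrite CE => /imsetP[i0 _ ->]; rewrite ends_e.
  by case/set2P=> ->; [exists i0|exists (ordS i0)].
have l0 : 0 < l by lia.
have c0 i : connect (adj C) (v (Ordinal l0)) (v i).
  case: i; elim=> [|i IH] il.
    by rewrite (_ : Ordinal il = Ordinal l0) //; apply: val_inj.
  have il' : i < l by lia.
  apply: connect_trans (IH il') _; apply: connect1.
  apply: (@adjI _ _ (e (Ordinal il'))); first by rewrite CE imset_f.
  rewrite ends_e; congr [set _; v _]; apply: val_inj => /=.
  by rewrite modn_small.
move=> /cv[i ->] /cv[j ->]; apply: connect_trans (c0 j).
by rewrite (sym_connect_sym (@adj_sym U C)).
Qed.

(** A forest is balanced whatever the prescription [tau]: when an edge is added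
to it, its ends lie in different components, and swapping the values on one of
these components achieves the prescribed value on the new edge. *)
Lemma acyclic_potential (U : multigraph) (A : {set edge U})
    (tau : edge U -> bool) :
    (forall C, is_cycle C -> ~~ (C \subset A)) ->
  exists sg : vertex U -> bool, forall e x y,
    e \in A -> ends e = [set x; y] -> sg x (+) sg y = tau e.
Proof.
elim: {A}_.+1 {-2}A (ltnSn #|A|) => // N IH A AN acyc.
have [->|[f fA]] := set_0Vmem A; first by exists xpred0 => e x y; rewrite inE.
have [||sg sgP] := IH (A :\ f).
- by rewrite (cardsD1 f) fA in AN.
- by move=> C /acyc; apply: contra => /subset_trans; apply; exact: subD1set.
have /eqP/cards2P[a [b [_ ef]]] := ends_card f.
pose reach := connect (adj (A :\ f)) a.
have reach_a : reach a by apply: connect0.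
have nreach_b : ~~ reach b.
  apply/negP=> /(cycle_through ef); rewrite !inE eqxx => /(_ isT)[C [cC _]].
  by rewrite setD1K // => /(negP (acyc C cC)).
exists (fun z => sg z (+) (reach z && (sg a (+) sg b != tau f))) => e x y eA ee.
have [fe|ef'] := eqVneq e f.
  have : (x, y) = (a, b) \/ (x, y) = (b, a).
    have ab := ends_neq ef; move: ef; rewrite -fe ee => E.
    have : a \in [set x; y] by rewrite E !inE eqxx.
    have : b \in [set x; y] by rewrite E !inE eqxx orbT.
    by case/set2P=> eb /set2P[] ea; move: ab; rewrite ea eb ?eqxx //; auto.
  rewrite fe; case=> -[-> ->]; rewrite reach_a (negPf nreach_b) /=;
    by case: (sg a) (sg b) (tau f) => [] [] [].
have eA' : e \in A :\ f by rewrite !inE ef'.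
have -> : reach x = reach y.
  apply: same_connect_r; first exact: (sym_connect_sym (@adj_sym U _)).
  exact/connect1/(adjI eA' ee).
by rewrite -(sgP _ _ _ eA' ee); case: (sg x) (sg y) (reach y && _) => [] [] [].
Qed.

(** * Inverses of unitriangular integer matrices *)

Section Matrices.
Local Open Scope ring_scope.
Variable n : nat.
Implicit Types (B : 'M[int]_n) (i j p q : 'I_n) (sg : 'I_n -> bool).

Lemma ltn_ord_eqF i j : (i < j)%N -> (i == j = false) * (j == i = false).
Proof. by move=> ij; rewrite -!(inj_eq val_inj) ltn_eqF // gtn_eqF. Qed.

Definition unitriangular B :=
  forall i j, (j <= i)%N -> B i j = (i == j)%:R.

Lemma unitriangular_unit B : unitriangular B -> B \in unitmx.
Proof.
move=> uB; rewrite unitmxE -det_tr det_trig.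
  by rewrite big1 ?unitr1 // => i _; rewrite mxE uB // eqxx.
by apply/is_trig_mxP => i j ij; rewrite mxE uB ?(ltnW ij) // (ltn_ord_eqF ij).
Qed.

(** Row i of B B^-1 = 1: paths from i to j sorted by their first arc. *)
Lemma invmx_rec B i j : unitriangular B ->
  invmx B i j = (i == j)%:R - \sum_(l : 'I_n | (i < l)%N) B i l * invmx B l j.
Proof.
move=> uB; have /matrixP/(_ i j) := mulmxV (unitriangular_unit uB).
rewrite !mxE (bigD1 i) //= uB // eqxx mul1r => <-.
rewrite [X in _ - X]big_mkcond [X in _ + X - _]big_mkcond -addrA -sumrB.
rewrite big1 ?addr0 // => l _.
case: (ltngtP i l) => [il|il|/val_inj->].
- by rewrite (ltn_ord_eqF il) subrr.
- by rewrite (ltn_ord_eqF il) subr0 uB ?(ltnW il) // (ltn_ord_eqF il) mul0r.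
- by rewrite eqxx subrr.
Qed.

Lemma ord_down_ind (P : 'I_n -> Prop) :
  (forall i, (forall l : 'I_n, (i < l)%N -> P l) -> P i) -> forall i, P i.
Proof.
move=> IH i; have [k] := ubnP (n - i); elim: k i => // k IHk i ik.
by apply: IH => l il; apply: IHk; have := ltn_ord l; lia.
Qed.

Lemma invmx_unitriangular B : unitriangular B -> unitriangular (invmx B).
Proof.
move=> uB; elim/ord_down_ind => i IH j ji.
rewrite invmx_rec // big1 ?subr0 // => l il.
have jl := leq_ltn_trans ji il.
by rewrite IH ?(ltnW jl) // (ltn_ord_eqF jl) mulr0.
Qed.

Lemma invmx_ge0 B : unitriangular B ->
  (forall i j, (i < j)%N -> B i j <= 0) -> forall i j, 0 <= invmx B i j.
Proof.
move=> uB B0 i j; elim/ord_down_ind: i => i IH.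
rewrite invmx_rec // addr_ge0 ?ler0n // -sumrN sumr_ge0 // => l il.
by rewrite -mulNr mulr_ge0 ?IH // oppr_ge0 B0.
Qed.

Lemma invmx_le_arc B : unitriangular B ->
  (forall i j, (i < j)%N -> B i j <= 0) ->
  forall i j, (i < j)%N -> - B i j <= invmx B i j.
Proof.
move=> uB B0 i j ij; rewrite invmx_rec // (ltn_ord_eqF ij) add0r.
rewrite lerN2 (bigD1 j) //= invmx_unitriangular // eqxx mulr1.
rewrite gerDl sumr_le0 // => l /andP[il _].
by rewrite mulr_le0_ge0 ?B0 ?invmx_ge0.
Qed.

(** When the inverse counts paths without signs, paths from i to j through l
are some of the paths from i to j. *)
Lemma invmx_concat B : unitriangular B ->
  (forall i j, (i < j)%N -> B i j <= 0) ->
  forall i j l, invmx B i l * invmx B l j <= invmx B i j.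
Proof.
move=> uB B0 i j l; have X0 := invmx_ge0 uB B0.
elim/ord_down_ind: i => i IH; have [->|il] := eqVneq i l.
  by rewrite invmx_unitriangular // eqxx mul1r.
rewrite [X in X * _]invmx_rec // [X in _ <= X]invmx_rec // (negPf il) add0r.
apply: (@le_trans _ _ (- \sum_(k : 'I_n | (i < k)%N) B i k * invmx B k j));
  last first.
  by rewrite lerDr ler0n.
rewrite mulNr lerN2 mulr_suml ler_sum // => k ik.
by rewrite -mulrA ler_wnM2l ?B0 ?IH.
Qed.

(** With Y = B^-1, the inverse of B + E_pq is Y - Y E_pq Y, because
E_pq Y E_pq = Y_qp E_pq = 0. The correction removes Y_ip Y_qj from Y_ij, no more
than the number Y_ip Y_pq Y_qj of paths through p and then q. *)
Lemma invmx_ge0_cancel B p q : unitriangular B -> (p < q)%N ->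
  (forall i j, (i < j)%N -> B i j <= 0) -> 1 <= invmx B p q ->
  forall i j, 0 <= invmx (B + delta_mx p q) i j.
Proof.
move=> uB pq B0 Ypq i j; set Y := invmx B.
have uBu := unitriangular_unit uB.
have -> : invmx (B + delta_mx p q) = Y - Y *m delta_mx p q *m Y.
  have EYE : delta_mx p q *m Y *m delta_mx p q = 0 :> 'M[int]_n.
    apply/matrixP=> a b; rewrite !mxE big1 // => c _; rewrite !mxE.
    have [->|] := eqVneq c p; last by rewrite mulr0.
    rewrite big1 ?mul0r // => d _; rewrite !mxE.
    have [->|] := eqVneq d q; last by rewrite andbF mul0r.
    by rewrite invmx_unitriangular ?(ltnW pq) // (ltn_ord_eqF pq) mulr0.
  have K : (B + delta_mx p q) *m (Y - Y *m delta_mx p q *m Y) = 1%:M.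
    rewrite mulmxDl !mulmxBr mulmxV // !mulmxA mulmxV // mul1mx.
    by rewrite EYE mul0mx subr0 subrK.
  have [uBE _] := mulmx1_unit K.
  by rewrite -[LHS]mulmx1 -K mulKmx.
rewrite !mxE subr_ge0 (bigD1 q) //= big1 ?addr0; last first.
  move=> c cq; rewrite !mxE big1 ?mul0r // => d _.
  by rewrite !mxE (negPf cq) andbF mulr0.
rewrite !mxE (bigD1 p) //= big1 ?addr0; last first.
  by move=> d dp; rewrite !mxE (negPf dp) mulr0.
rewrite !mxE !eqxx mulr1.
apply: le_trans (invmx_concat uB B0 i j p).
rewrite -/Y ler_wpM2l ?invmx_ge0 //.
apply: le_trans (invmx_concat uB B0 p j q).
by rewrite -/Y ler_peMl ?invmx_ge0.
Qed.

Definition sign_conj sg B : 'M[int]_n :=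
  \matrix_(i, j) ((-1) ^+ (sg i (+) sg j) * B i j).

Lemma sign_conjE sg B :
  let D := diag_mx (\row_i (-1) ^+ sg i) in sign_conj sg B = D *m B *m D.
Proof.
apply/matrixP=> i j; rewrite mul_mx_diag mul_diag_mx !mxE signr_addb.
by rewrite mulrAC.
Qed.

Lemma sign_conj_unitriangular sg B :
  unitriangular B -> unitriangular (sign_conj sg B).
Proof.
move=> uB i j ji; rewrite mxE uB //; have [->|] := eqVneq i j.
  by rewrite addbb mulr1.
by rewrite mulr0.
Qed.

Lemma invmx_neq0_step B i j : unitriangular B -> i != j -> invmx B i j != 0 ->
  exists l : 'I_n, [/\ (i < l)%N, B i l != 0 & invmx B l j != 0].
Proof.
move=> uB ij; rewrite invmx_rec // (negPf ij) sub0r oppr_eq0 => S0.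
case: (pickP (fun l : 'I_n => [&& (i < l)%N, B i l != 0 & invmx B l j != 0])).
  by move=> l /and3P; exists l.
move=> no; case/eqP: S0; rewrite big1 // => l il; have := no l.
by rewrite il /= -negb_or; move=> /negbFE/orP[] /eqP->; rewrite ?mul0r ?mulr0.
Qed.

(** The arc i -> j alone contributes a negative amount to the (i, j) entry of
the inverse; only a path with another first step can compensate for it. *)
Lemma invmx_ge0_detour B i j : unitriangular B -> (i < j)%N ->
    0 < B i j -> 0 <= invmx B i j ->
  exists l : 'I_n, [/\ (i < l)%N, l != j, B i l != 0 & invmx B l j != 0].
Proof.
move=> uB ij Bij X0.
case: (pickP (fun l : 'I_n =>
    [&& (i < l)%N, l != j, B i l != 0 & invmx B l j != 0])).
  by move=> l /and4P; exists l.
move=> no; move: X0; rewrite invmx_rec // (ltn_ord_eqF ij) sub0r oppr_ge0.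
rewrite (bigD1 j) //= big1 => [|l /andP[il lj]].
  by rewrite addr0 invmx_unitriangular // eqxx mulr1 leNgt Bij.
have := no l; rewrite il lj /= -negb_or.
by move=> /negbFE/orP[] /eqP->; rewrite ?mul0r ?mulr0.
Qed.

Lemma invmx_sign_conj sg B : B \in unitmx ->
  invmx (sign_conj sg B) = sign_conj sg (invmx B).
Proof.
move=> uB; rewrite !sign_conjE; set D := diag_mx _.
have DD : D *m D = 1%:M.
  apply/matrixP=> i j; rewrite mul_diag_mx !mxE.
  by have [->|] := eqVneq i j; rewrite ?mulr0 // mulr1n -signr_addb addbb.
have K : (D *m B *m D) *m (D *m invmx B *m D) = 1%:M.
  by rewrite !mulmxA -[D *m B *m D *m D]mulmxA DD mulmx1 mulmxK.
have [uK _] := mulmx1_unit K.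
by rewrite -[LHS]mulmx1 -K mulKmx.
Qed.

(** The equality of absolute values amounts to non-negative entries after
conjugation; boolean signs make the parity arguments available. *)
Lemma digraph_invertibleP (D : multidigraph n) :
  digraph_invertible D <->
  exists sg, forall i j, 0 <= sign_conj sg (invmx (digraph_mx D)) i j.
Proof.
rewrite /digraph_invertible; set X := invmx _; split.
  case=> s [s1 sX]; exists (fun i => s ord0 i == -1) => i j.
  have sE l : s ord0 l = (-1) ^+ (s ord0 l == -1).
    by case: (s1 l) => ->.
  have : 0 <= (diag_mx s *m X *m diag_mx s) i j by rewrite sX mxE.
  by rewrite mul_mx_diag mul_diag_mx !mxE signr_addb -!sE mulrAC.
case=> sg sgX; exists (\row_i (-1) ^+ sg i); split.
  by move=> i; rewrite mxE; case: (sg i); [right|left].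
rewrite -sign_conjE; apply/matrixP=> i j; rewrite -[LHS](ger0_norm (sgX i j)).
by rewrite !mxE normrM normr_sign mul1r.
Qed.

End Matrices.

(** * Labelled bipartite graphs with one cycle *)

Section Labelled.
(* An edge [e] is handled through its labels: it joins the left vertex [src e] to
   the right vertex [tgt e], hence is the arc [src e] -> [tgt e] of the digraph
   unless it is matched; [mate i] is the matched edge with both labels [i]. *)
Variables (U : multigraph) (n : nat) (lab : 'I_(n + n) -> vertex U).
Variables (M : {set edge U}) (src tgt : edge U -> 'I_n) (mate : 'I_n -> edge U).
Hypothesis lab_inj : injective lab.
Hypothesis ends_lab : forall e, ends e = lab_pair lab (src e) (tgt e).
Hypothesis matchE : forall e, (e \in M) = (src e == tgt e).
Hypothesis src_lt_tgt : forall e, e \notin M -> src e < tgt e.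
Hypothesis mateP : forall e i, (src e == i) && (tgt e == i) = (e == mate i).

Let L i := lab (lshift n i).
Let R i := lab (rshift n i).

Lemma mem_endsL e i : (L i \in ends e) = (src e == i).
Proof.
by rewrite ends_lab !inE !(inj_eq lab_inj) eq_lshift eq_lrshift orbF eq_sym.
Qed.

Lemma mem_endsR e i : (R i \in ends e) = (tgt e == i).
Proof.
by rewrite ends_lab !inE !(inj_eq lab_inj) eq_rshift eq_rlshift eq_sym.
Qed.

Lemma src_mate i : src (mate i) = i.
Proof. by have := mateP (mate i) i; rewrite eqxx => /andP[/eqP]. Qed.

Lemma tgt_mate i : tgt (mate i) = i.
Proof. by have := mateP (mate i) i; rewrite eqxx => /andP[_ /eqP]. Qed.

Lemma mate_inj : injective mate.
Proof. exact: can_inj src_mate. Qed.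

Lemma mate_in i : mate i \in M.
Proof. by rewrite matchE src_mate tgt_mate. Qed.

Lemma matched_mate e : e \in M -> e = mate (src e).
Proof. by rewrite matchE => /eqP st; apply/eqP; rewrite -mateP -st eqxx. Qed.

Let B := digraph_mx (associated_digraph lab).

Lemma digraph_mxE i j : i != j ->
  B i j = #|[set e | (src e == i) && (tgt e == j)]|%:R%R.
Proof.
move=> ij; rewrite mxE (negPf ij); congr (_%:R)%R.
set S := [set a | _].
pose g (a : Defs.arc (associated_digraph lab)) := (val a).1.
have aP (a : Defs.arc (associated_digraph lab)) :
    src (g a) = source a /\ tgt (g a) = target a.
  case: a => -[e [x y]] /= H; rewrite /g /=; case/andP: (H) => /= _ /eqP ee.
  split; apply/eqP; first by rewrite -mem_endsL ee !inE eqxx.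
  by rewrite -mem_endsR ee !inE eqxx orbT.
suff <- : g @: S = [set e | (src e == i) && (tgt e == j)].
  rewrite card_in_imset // => a b; rewrite !inE => /andP[/eqP sa /eqP ta].
  case/andP=> /eqP sb /eqP tb gab; apply: val_inj.
  case: a b sa ta sb tb gab => -[e [x y]] /= H [[e' [x' y']] /= H'].
  by rewrite /g /= => -> -> -> -> ->.
apply/setP=> e; rewrite inE; apply/imsetP/andP.
  case=> a; rewrite inE => /andP[/eqP sa /eqP ta] ->.
  by have [-> ->] := aP a; rewrite sa ta.
case=> /eqP si /eqP tj.
have H : ((e, (i, j)).2.1 != (e, (i, j)).2.2) &&
         (ends (e, (i, j)).1 == lab_pair lab (e, (i, j)).2.1 (e, (i, j)).2.2).
  by rewrite /= ij ends_lab si tj eqxx.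
by exists (exist _ (e, (i, j)) H); rewrite // inE /= !eqxx.
Qed.

Lemma digraph_mx_unitriangular : unitriangular B.
Proof.
move=> i j ji; have [->|ij] := eqVneq i j; first by rewrite mxE eqxx.
rewrite digraph_mxE // (_ : [set e | _] = set0) ?cards0 //.
apply/setP=> e; rewrite !inE; apply/negP=> /andP[/eqP si /eqP tj].
have : src e < tgt e by apply: src_lt_tgt; rewrite matchE si tj.
by rewrite si tj ltnNge ji.
Qed.

Variable C : {set edge U}.
Hypothesis cycC : is_cycle C.
Hypothesis uniC : forall C', is_cycle C' -> C' = C.

Let cL := [set i | L i \in covered C].
Let cR := [set i | R i \in covered C].
Let K := [set i | mate i \in C].

Lemma src_covered e : e \in C -> src e \in cL.
Proof.
move=> eC; rewrite inE; apply/bigcupP; exists e => //.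
by rewrite mem_endsL.
Qed.

Lemma tgt_covered e : e \in C -> tgt e \in cR.
Proof.
move=> eC; rewrite inE; apply/bigcupP; exists e => //.
by rewrite mem_endsR.
Qed.

(** Double counting: each left vertex of the cycle lies on two cycle edges. *)
Lemma sum_src (g : 'I_n -> nat) :
  \sum_(e in C) g (src e) = 2 * \sum_(i in cL) g i.
Proof.
rewrite (partition_big src xpredT) //= big_distrr [RHS]big_mkcond /=.
apply: eq_bigr => i _; rewrite (eq_bigr (fun=> g i)); last first.
  by move=> e /andP[_ /eqP->].
rewrite sum_nat_const; have := cycle_degree (L i) cycC.
under eq_finset do rewrite mem_endsL.
rewrite cardsE inE => ->.
by case: ifP => _; lia.
Qed.

Lemma sum_tgt (g : 'I_n -> nat) :
  \sum_(e in C) g (tgt e) = 2 * \sum_(i in cR) g i.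
Proof.
rewrite (partition_big tgt xpredT) //= big_distrr [RHS]big_mkcond /=.
apply: eq_bigr => i _; rewrite (eq_bigr (fun=> g i)); last first.
  by move=> e /andP[_ /eqP->].
rewrite sum_nat_const; have := cycle_degree (R i) cycC.
under eq_finset do rewrite mem_endsR.
rewrite cardsE inE => ->.
by case: ifP => _; lia.
Qed.

Lemma card_cycle_src : #|C| = 2 * #|cL|.
Proof. by rewrite -!sum1_card (sum_src (fun=> 1)). Qed.

Lemma card_cycle_tgt : #|C| = 2 * #|cR|.
Proof. by rewrite -!sum1_card (sum_tgt (fun=> 1)). Qed.

Lemma K_sub_cL : K \subset cL.
Proof. by apply/subsetP=> i; rewrite inE => /src_covered; rewrite src_mate. Qed.

Lemma K_sub_cR : K \subset cR.
Proof. by apply/subsetP=> i; rewrite inE => /tgt_covered; rewrite tgt_mate. Qed.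

(** A matched edge with both ends on the cycle and not in it would close a path
of the cycle into a second cycle. *)
Lemma no_chord : cL :&: cR = K.
Proof.
apply/eqP; rewrite eqEsubset subsetI K_sub_cL K_sub_cR !andbT.
apply/subsetP=> i; rewrite !inE => /andP[iL iR].
have em : ends (mate i) = [set L i; R i] by rewrite ends_lab src_mate tgt_mate.
apply/negP=> /negP mC.
have [C' [cC' mC' _]] := cycle_through em mC (cycle_connected cycC iL iR).
by rewrite (uniC cC') (negPf mC) in mC'.
Qed.

Lemma card_matched_in_cycle : #|C :&: M| = #|K|.
Proof.
rewrite -(card_imset _ mate_inj); congr #|pred_of_set _|.
apply/setP=> e; rewrite inE; apply/andP/imsetP => [[eC eM]|[i + ->]].
  by exists (src e); rewrite -?matched_mate // inE -matched_mate.
by rewrite inE mate_in => ->.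
Qed.

Lemma incident_matchedE : incident_matched M C = mate @: ((cL :|: cR) :\: K).
Proof.
apply/setP=> e; rewrite inE; apply/and3P/imsetP.
  case=> eM eC /existsP[x /andP[xe xC]]; have eE := matched_mate eM.
  exists (src e) => //; rewrite !inE -eE eC /=.
  have st : src e = tgt e by apply/eqP; rewrite -matchE.
  by move: xe xC; rewrite ends_lab -st => /set2P[] -> ->; rewrite ?orbT.
case=> i; rewrite !inE => /andP[iC iLR] ->; split=> //; first exact: mate_in.
apply/existsP; case/orP: iLR => ic; [exists (L i)|exists (R i)].
  by rewrite mem_endsL src_mate eqxx.
by rewrite mem_endsR tgt_mate eqxx.
Qed.

Lemma card_incident_matched : #|C| = #|incident_matched M C| + 2 * #|K|.
Proof.
rewrite incident_matchedE (card_imset _ mate_inj) cardsD.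
have -> : (cL :|: cR) :&: K = K.
  by apply/setIidPr/(subset_trans K_sub_cL)/subsetUl.
have := cardsU cL cR; rewrite no_chord.
have := card_cycle_src; have := card_cycle_tgt.
have := subset_leq_card K_sub_cL; have := subset_leq_card K_sub_cR.
by lia.
Qed.

(** Signs return to themselves around a cycle: summed over the cycle edges,
each sign occurs twice. *)
Lemma cycle_parity (sg : 'I_n -> bool) :
  ~~ odd #|[set e in C | sg (src e) (+) sg (tgt e)]|.
Proof.
have -> : #|[set e in C | sg (src e) (+) sg (tgt e)]| =
    \sum_(e in C) (sg (src e) (+) sg (tgt e) : nat).
  rewrite -sum1_card big_mkcond [RHS]big_mkcond; apply: eq_bigr => e _.
  by rewrite inE; case: (e \in C) (_ (+) _) => [] [].
have := sum_src (fun i => sg i : nat); have := sum_tgt (fun i => sg i : nat).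
have : \sum_(e in C) ((sg (src e) : nat) + (sg (tgt e) : nat)) =
  \sum_(e in C) (sg (src e) (+) sg (tgt e) : nat) +
  2 * \sum_(e in C) (sg (src e) && sg (tgt e) : nat).
  rewrite big_distrr -big_split /=; apply: eq_bigr => e _.
  by case: (sg _) (sg _) => [] [].
by rewrite big_split /=; lia.
Qed.

Lemma unmatched_cycle_edge : exists2 f, f \in C & f \notin M.
Proof.
case: (set_0Vmem (C :\: M)) => [E|[f]]; last first.
  by rewrite inE => /andP[]; exists f.
have := cardsID M C; rewrite E cards0 card_matched_in_cycle card_cycle_src.
have := subset_leq_card K_sub_cL.
have [l [v [e [l1 _ _ _ CE]]]] := cycC.
have : 0 < #|cL|; last by lia.
apply/card_gt0P; exists (src (e (Ordinal (ltnW l1)))).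
by rewrite src_covered // CE imset_f.
Qed.

Lemma odd_unmatched : odd #|C :\: M| = odd #|K|.
Proof.
have := cardsID M C; rewrite card_matched_in_cycle card_cycle_src; lia.
Qed.

(** Removing [f] leaves a forest, on which signs equal along matched edges and
opposite along the others exist. Parity around the cycle then decides whether
[f] complies. *)
Lemma cycle_potential f : f \in C -> f \notin M ->
  exists sg : 'I_n -> bool, forall e,
    sg (src e) (+) sg (tgt e) = (e \notin M) (+) ((e == f) && odd #|K|).
Proof.
move=> fC fM.
have [|s sP] := @acyclic_potential U [set~ f] (fun e => e \notin M).
  move=> C' /uniC->; apply/negP=> /subsetP/(_ f fC).
  by rewrite !inE eqxx.
have sLR i : s (R i) = s (L i).
  have mf : mate i \in [set~ f].
    by rewrite !inE; apply: contraNneq fM => <-; apply: mate_in.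
  have := sP _ (L i) (R i) mf; rewrite ends_lab src_mate tgt_mate mate_in.
  by move/(_ erefl); case: (s _) (s _) => [] [].
exists (fun i => s (L i)) => e; have [->|ef] := eqVneq e f; last first.
  rewrite addbF -(sP e (L (src e)) (R (tgt e))) ?inE ?sLR //;
  exact: ends_lab.
have := cycle_parity (fun i => s (L i)); set S := [set e in C | _].
have SE : S :\ f = (C :\: M) :\ f.
  apply/setP=> e'; rewrite !inE; case: eqVneq => //= ef.
  rewrite andbC -(sP e' (L (src e')) (R (tgt e'))) ?inE ?sLR //;
  exact: ends_lab.
have := odd_unmatched; rewrite (cardsD1 f) (cardsD1 f S) SE !inE fC fM /=.
rewrite add0n => <-; rewrite oddD oddb negbK.
by move: (s _ (+) s _) => b; case: b; case: (odd _).
Qed.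

Lemma edge_of_entry i j : i != j -> B i j != 0%R ->
  exists e, [/\ e \notin M, src e = i & tgt e = j].
Proof.
move=> ij; rewrite digraph_mxE // pnatr_eq0 -lt0n => /card_gt0P[e].
rewrite inE => /andP[/eqP si /eqP tj]; exists e.
by rewrite matchE si tj.
Qed.

Lemma entry_of_edge e : e \notin M -> (1 <= B (src e) (tgt e))%R.
Proof.
move=> eM; rewrite digraph_mxE -?matchE // ler1n.
by apply/card_gt0P; exists e; rewrite inE !eqxx.
Qed.

Lemma sign_conj_le0 (sg : 'I_n -> bool) (i j : 'I_n) : i < j ->
  (forall e, src e = i -> tgt e = j -> sg i (+) sg j) ->
  (sign_conj sg B i j <= 0)%R.
Proof.
move=> ij sgP; rewrite mxE.
have [->|] := eqVneq (B i j) 0%R; first by rewrite mulr0.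
move=> /(edge_of_entry _)[|e [_ si tj]]; first by rewrite (ltn_ord_eqF ij).
rewrite (sgP e si tj) expr1 mulN1r oppr_le0.
by rewrite digraph_mxE ?ler0n // (ltn_ord_eqF ij).
Qed.

(** With an even number of matched edges on the cycle, the signs alternate along
every arc. *)
Lemma even_invertible :
  ~~ odd #|K| -> digraph_invertible (associated_digraph lab).
Proof.
move=> K0; have [f fC fM] := unmatched_cycle_edge.
have [sg sgP] := cycle_potential fC fM.
apply/digraph_invertibleP; exists sg.
have uB := digraph_mx_unitriangular.
rewrite -invmx_sign_conj ?unitriangular_unit //.
apply: invmx_ge0 => [|i j ij]; first exact: sign_conj_unitriangular.
apply: sign_conj_le0 => // e si tj; rewrite -si -tj sgP (negPf K0) andbF addbF.
by rewrite matchE si tj (ltn_ord_eqF ij).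
Qed.

Lemma shortcut_covered f : f \in C -> src f \notin K -> tgt f \notin K ->
  cL \subset src f |: K -> cL = src f |: K /\ cR = tgt f |: K.
Proof.
move=> fC pK qK cLK.
have cLE : cL = src f |: K.
  by apply/eqP; rewrite eqEsubset cLK subUset sub1set src_covered ?K_sub_cL.
split=> //; apply/eqP; rewrite eq_sym eqEcard subUset sub1set tgt_covered //.
rewrite K_sub_cR /= cardsU1 qK -[_ + _]/(#|K|.+1).
have : #|cL| = #|K|.+1 by rewrite cLE cardsU1 pK.
by move=> <-; rewrite -(@leq_pmul2l 2) // -card_cycle_src -card_cycle_tgt.
Qed.

(** The arc [f] is parallel to the rest of the cycle, a directed path of even
length; their contributions to the inverse cancel and every other arc can have
alternating signs. *)
Lemma shortcut_invertible f : odd #|K| -> f \in C ->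
    src f \notin K -> tgt f \notin K -> cL \subset src f |: K ->
  digraph_invertible (associated_digraph lab).
Proof.
set p := src f; set q := tgt f => K1 fC pK qK cLK.
have uB := digraph_mx_unitriangular.
have fM : f \notin M.
  by apply: contraNN pK => fM; rewrite inE -(matched_mate fM).
have pq : p < q by apply: src_lt_tgt.
have [sg sgP] := cycle_potential fC fM.
have sgpq : sg p (+) sg q = false by rewrite sgP fM eqxx K1.
have sg1 e : e \notin M -> e != f -> sg (src e) (+) sg (tgt e).
  by move=> eM ef; rewrite sgP eM (negPf ef).
have uniq_f e : src e = p -> tgt e = q -> e = f.
  move=> sp tq; apply/eqP/contraT => /sg1; rewrite sp tq sgpq; apply.
  by rewrite matchE sp tq (ltn_ord_eqF pq).
pose B0 := (sign_conj sg B - delta_mx p q)%R.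
have B0m i j : B0 i j = (sign_conj sg B i j - ((i == p) && (j == q))%:R)%R.
  by rewrite mxE [X in (_ + X)%R]mxE [delta_mx _ _ _ _]mxE.
have uB0 : unitriangular B0.
  move=> i j ji; rewrite B0m (sign_conj_unitriangular sg uB ji).
  case: (i =P p) => [ip|]; case: (j =P q) => [jq|]; rewrite ?subr0 //.
  by move: ji; rewrite ip jq leqNgt pq.
have B0E i j : (i, j) != (p, q) -> B0 i j = sign_conj sg B i j.
  by rewrite B0m xpair_eqE => /negPf->; rewrite subr0.
have B0pq : B0 p q = 0%R.
  rewrite B0m mxE sgpq !eqxx mul1r digraph_mxE ?(ltn_ord_eqF pq) //.
  rewrite (_ : [set e | _] = [set f]) ?cards1 ?subrr //.
  apply/setP=> e; rewrite !inE; apply/andP/eqP => [[/eqP sp /eqP tq]|->].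
    exact: uniq_f.
  by rewrite !eqxx.
have B0le (i j : 'I_n) : i < j -> (B0 i j <= 0)%R.
  move=> ij; have [[-> ->]|ne] := eqVneq (i, j) (p, q); first by rewrite B0pq.
  rewrite B0E //; apply: sign_conj_le0 => // e si tj; rewrite -si -tj.
  apply: sg1; first by rewrite matchE si tj (ltn_ord_eqF ij).
  by apply: contraNneq ne => ef; rewrite -si -tj ef.
have step e : e \notin M -> e != f -> (1 <= invmx B0 (src e) (tgt e))%R.
  move=> eM ef; apply: le_trans (invmx_le_arc uB0 B0le (src_lt_tgt eM)).
  rewrite B0E; last by apply: contraNneq ef => -[sp tq]; exact/eqP/uniq_f.
  by rewrite mxE sg1 // expr1 mulN1r opprK entry_of_edge.
suff Ypq : (1 <= invmx B0 p q)%R.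
  apply/digraph_invertibleP; exists sg.
  rewrite -invmx_sign_conj ?unitriangular_unit //.
  rewrite -[sign_conj sg B](subrK (delta_mx p q)).
  exact: invmx_ge0_cancel.
(* The set [W] of the vertices reached from p without [f] is closed under all
   arcs but [f]. If it missed q, it would contain one more left vertex of the
   cycle (namely p) than right ones, so that two more cycle edges would start
   in [W] than end in it; but only [f] can start in [W] and end outside. *)
pose W := [set i | (1 <= invmx B0 p i)%R].
have pW : p \in W by rewrite inE invmx_unitriangular // eqxx.
have WP e : e != f -> src e \in W -> tgt e \in W.
  have [|eM ef] := boolP (e \in M); first by rewrite matchE => /eqP->.
  rewrite !inE => Ws; apply: le_trans (invmx_concat uB0 B0le p (tgt e) (src e)).
  by rewrite -[1%R]mulr1; apply: ler_pM => //; apply: step.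
have [|qW] := boolP (q \in W); first by rewrite inE.
have [cLE cRE] := shortcut_covered fC pK qK cLK; rewrite -/p -/q in cLE cRE.
have := sum_src (fun i => i \in W : nat).
have := sum_tgt (fun i => i \in W : nat).
rewrite cLE cRE !big_setU1 //= pW (negPf qW).
rewrite (bigD1 f) // [in X in _ -> X](bigD1 f) //= pW (negPf qW) add0n add1n.
have : \sum_(e in C | e != f) (src e \in W) <=
       \sum_(e in C | e != f) (tgt e \in W).
  apply: leq_sum => e /andP[_ ef].
  by case sW: (src e \in W) => //; rewrite (WP e ef sW).
set r := \sum_(_ in K) _; set s := \sum_(_ in C | _) _.
set t := \sum_(_ in C | _) _; clearbody r s t.
by rewrite /nat_of_bool => s_le_t tr sr; exfalso; clear -s_le_t tr sr; lia.
Qed.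

(** A cycle arc with equal signs at its ends p and q has a detour from p to q.
Fix one outgoing arc at each vertex that leads to q, avoiding [f] and ending
where q can still be reached. These arcs and the matched edges away from p and q
connect p to q, and a left vertex other than p has degree at most 2 in them, one
of the two edges being its matched edge. The cycle closed by [f] therefore
contains the matched edge of each of its left vertices except p. *)
Lemma invertible_shortcut : odd #|K| ->
    digraph_invertible (associated_digraph lab) ->
  exists f,
    [/\ f \in C, src f \notin K, tgt f \notin K & cL \subset src f |: K].
Proof.
move=> K1 /digraph_invertibleP[sg sgX].
have uB := digraph_mx_unitriangular.
have [f /andP[/setDP[fC fM] sgf]] :
    exists f, (f \in C :\: M) && ~~ (sg (src f) (+) sg (tgt f)).
  case: (pickP (fun f => (f \in C :\: M) && ~~ (sg (src f) (+) sg (tgt f)))).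
    by move=> f; exists f.
  move=> no; have := cycle_parity sg; rewrite (_ : [set e in C | _] = C :\: M).
    by rewrite odd_unmatched K1.
  apply/setP=> e; rewrite inE; have := no e; rewrite inE.
  have [|eM] := boolP (e \in M).
    by rewrite matchE => /eqP->; rewrite addbb andbF.
  by case: (e \in C) => //= /negbFE.
set X := invmx B in sgX; pose p := src f; pose q := tgt f.
have pq : p < q by apply: src_lt_tgt.
have Xpq : (0 <= X p q)%R by have := sgX p q; rewrite mxE (negPf sgf) mul1r.
pose good i e := [/\ e \notin M, e != f, src e = i & X (tgt e) q != 0%R].
have [g gP] : exists g : 'I_n -> edge U, forall i,
    i != q -> (i == p) || (X i q != 0%R) -> good i (g i).
  apply: (@fin_all_exists _ (fun=> edge U) (fun i e =>
    i != q -> (i == p) || (X i q != 0%R) -> good i e)) => i.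
  have [-> | ip] := eqVneq i p.
    have Bpq : (0 < B p q)%R := lt_le_trans ltr01 (entry_of_edge fM).
    have [l [pl lq Bl Xl]] := invmx_ge0_detour uB pq Bpq Xpq.
    have [|e [eM sp tl]] := edge_of_entry _ Bl.
      by rewrite (ltn_ord_eqF pl).
    exists e => _ _; split; rewrite ?tl //.
    by apply: contraNneq lq => ef; rewrite -tl ef.
  have [->|iq] := eqVneq i q; first by exists f.
  have [Xi|Xi] := eqVneq (X i q) 0%R; first by exists f.
  have [l [il Bl Xl]] := invmx_neq0_step uB iq Xi.
  have [|e [eM si tl]] := edge_of_entry _ Bl; first by rewrite (ltn_ord_eqF il).
  exists e => _ _; split; rewrite ?tl //.
  by apply: contraNneq ip => ef; rewrite -si ef.
(* At indices i that do not lead to q, the arc [g i] is arbitrary; this is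
   harmless as only the degree bound matters there. *)
pose A := [set e | (e != f) &&
  if e \in M then (src e != p) && (src e != q) else e == g (src e)].
have mateA i : mate i \in f |: A -> (i != p) && (i != q).
  rewrite !inE mate_in src_mate => /orP[/eqP mf|/andP[]//].
  by rewrite -mf mate_in in fM.
have reach (i : 'I_n) : p <= i -> i != q -> (i == p) || (X i q != 0%R) ->
    connect (adj A) (L i) (R q).
  elim/ord_down_ind: i => i IH pi iq Xi.
  have [eM ef si Xt] := gP i iq Xi.
  have gA : g i \in A by rewrite inE ef (negPf eM) si eqxx.
  have eg : ends (g i) = [set L i; R (tgt (g i))] by rewrite ends_lab si.
  have it : i < tgt (g i) by have := src_lt_tgt eM; rewrite si.
  apply: connect_trans (connect1 (adjI gA eg)) _.
  have [->|tq] := eqVneq (tgt (g i)) q; first exact: connect0.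
  have pt := leq_ltn_trans pi it.
  apply: connect_trans (IH _ it (ltnW pt) tq _); last by rewrite Xt orbT.
  apply: connect1; apply: (@adjI _ _ (mate (tgt (g i)))).
    rewrite inE mate_in src_mate tq (ltn_ord_eqF pt) !andbT.
    by apply: contraNneq fM => <-; apply: mate_in.
  by rewrite ends_lab src_mate tgt_mate setUC.
have fA : f \notin A by rewrite inE eqxx.
have pq' : p != q by rewrite (ltn_ord_eqF pq).
have [|C' [cC' _]] := cycle_through (ends_lab f) fA.
  by apply: reach; rewrite ?eqxx.
rewrite (uniC cC') => /subsetP CA.
exists f; split=> //.
- by rewrite inE; apply/negP=> /CA/mateA; rewrite eqxx.
- by rewrite inE; apply/negP=> /CA/mateA; rewrite eqxx andbF.
apply/subsetP=> i iL; rewrite !inE -/p; have [//|ip] := eqVneq i p.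
apply/negPn/negP=> mC.
have := cycle_degree (L i) cycC; move: iL; rewrite inE => ->.
under eq_finset do rewrite mem_endsL.
suff /subset_leq_card : [set e in C | src e == i] \subset [set g i].
  by rewrite cards1; lia.
apply/subsetP=> e; rewrite !inE => /andP[eC /eqP si].
have := CA e eC; rewrite !inE => /orP[/eqP ef|/andP[_]].
  by case/eqP: ip; rewrite -si ef.
case: ifP => [eM _|_]; last by rewrite si.
by rewrite -si -matched_mate ?eC in mC.
Qed.

(** The exceptional case of the theorem in terms of one cycle edge [f]: it joins
the two cycle vertices that are not matched within the cycle. *)
Lemma adjacent_incidentP k : #|incident_matched M C| = 2 * k ->
  (k = 1 /\ exists e1 e2 : edge U,
     [/\ e1 != e2, incident_matched M C = [set e1; e2]
       & at_adjacent_cycle_vertices C e1 e2]) <->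
  exists f,
    [/\ f \in C, src f \notin K, tgt f \notin K & cL \subset src f |: K].
Proof.
move=> kE; have := card_incident_matched; rewrite kE card_cycle_src => cardL.
split=> [[k1 [e1 [e2 [_ incE [v1 [v2 [v1e v2e [f fC ef]]]]]]]]|].
  have off x : x \in ends f ->
      exists e, [/\ e \in M, e \notin C & x \in ends e].
    have inc e : e \in incident_matched M C -> e \in M /\ e \notin C.
      by rewrite inE => /and3P[].
    rewrite ef => /set2P[] ->; [exists e1|exists e2].
      by have [] := inc e1; rewrite ?incE ?inE ?eqxx.
    by have [] := inc e2; rewrite ?incE ?inE ?eqxx ?orbT.
  have pK : src f \notin K.
    have [|e [eM eC]] := off (L (src f)); first by rewrite mem_endsL.
    by rewrite mem_endsL inE => /eqP<-; rewrite -matched_mate.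
  exists f; split=> //.
    have [|e [eM eC]] := off (R (tgt f)); first by rewrite mem_endsR.
    rewrite mem_endsR inE => /eqP<-.
    by move: (eM); rewrite matchE => /eqP<-; rewrite -matched_mate.
  have : src f |: K == cL.
    rewrite eqEcard subUset sub1set src_covered // K_sub_cL /= cardsU1 pK.
    by rewrite -(@leq_pmul2l 2) // cardL k1 mulnDr.
  by move/eqP->.
case=> f [fC pK qK cLK]; have [cLE cRE] := shortcut_covered fC pK qK cLK.
have k1 : k = 1.
  by move: cardL; rewrite cLE cardsU1 pK -[_ + #|K|]/(#|K|.+1); clear; lia.
split=> //; exists (mate (src f)), (mate (tgt f)).
have pq : src f != tgt f.
  rewrite -matchE; apply: contraNN pK => fM.
  by rewrite inE -(matched_mate fM).
split; first by rewrite (inj_eq mate_inj).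
  rewrite incident_matchedE cLE cRE; apply/setP=> e; rewrite !inE.
  apply/imsetP/orP => [[i + ->]|].
    rewrite !inE; case: (mate i \in C) => //=.
    by rewrite !orbF => /orP[]/eqP->; [left|right].
  rewrite !inE in pK qK.
  case=> /eqP->; first by exists (src f); rewrite // !inE pK eqxx.
  by exists (tgt f); rewrite // !inE qK eqxx orbT.
exists (L (src f)), (R (tgt f)); split.
- by rewrite mem_endsL src_mate.
- by rewrite mem_endsR tgt_mate.
by exists f.
Qed.

End Labelled.

Theorem theorem3p22 (U : multigraph) (hcyc : unicyclic U)
    (hbip : bipartite U) (huniq : has_unique_perfect_matching U)
    (C M : {set edge U}) (hC : is_cycle C) (hM : perfect_matching M)
    (m k : nat) (hm : #|C| = 2 * m) (hk : #|incident_matched M C| = 2 * k)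
    (n : nat) (lab : 'I_(n + n) -> vertex U)
    (hlab : admissible_labelling M lab) :
  digraph_invertible (associated_digraph lab) <->
  ~~ odd (m + k) \/
  (k = 1 /\
   exists e1 e2 : edge U,
     [/\ e1 != e2, incident_matched M C = [set e1; e2]
       & at_adjacent_cycle_vertices C e1 e2]).
Proof.
case: hlab => /bij_inj lab_inj ME ends_ex arcs_ex.
have uniC C' : is_cycle C' -> C' = C.
  by case: hcyc => C0 [_ C0u] cC'; rewrite -(C0u _ cC') (C0u _ hC).
have [src [tgt ends_lab]] : exists src tgt : edge U -> 'I_n,
    forall e, ends e = lab_pair lab (src e) (tgt e).
  have [src /fin_all_exists[tgt st]] := fin_all_exists ends_ex.
  by exists src, tgt.
have sE := mem_endsL lab_inj ends_lab; have tE := mem_endsR lab_inj ends_lab.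
have matchE e : (e \in M) = (src e == tgt e).
  rewrite ME inE; apply/existsP/eqP => [[i /eqP ee]|st]; last first.
    by exists (src e); rewrite {2}st ends_lab.
  have /eqP-> : src e == i by rewrite -sE ee !inE eqxx.
  by apply/esym/eqP; rewrite -tE ee !inE eqxx orbT.
have src_lt e : e \notin M -> src e < tgt e.
  move=> /arcs_ex[i [j [ij ee]]].
  have /eqP-> : src e == i by rewrite -sE ee !inE eqxx.
  by have /eqP-> : tgt e == j by rewrite -tE ee !inE eqxx orbT.
have [mate mateP] : exists mate : 'I_n -> edge U,
    forall i e, (src e == i) && (tgt e == i) = (e == mate i).
  apply: (@fin_all_exists _ (fun=> edge U) (fun i e0 =>
    forall e, (src e == i) && (tgt e == i) = (e == e0))) => i.
  have /eqP/cards1P[e0 e0P] := hM (lab (lshift n i)).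
  exists e0 => e; move/setP/(_ e): e0P; rewrite !inE sE matchE => <-.
  by case: eqP => [->|]; rewrite ?andbT ?andbF // eq_sym.
have mateP' e i := mateP i e.
set K := [set i | mate i \in C].
have oddK : odd (m + k) = odd #|K|.
  have := card_incident_matched lab_inj ends_lab matchE mateP' hC uniC.
  by rewrite hm hk -/K; clear; lia.
rewrite oddK (adjacent_incidentP lab_inj ends_lab matchE mateP' hC uniC hk).
have [K1|K0] := boolP (odd #|K|).
  split=> [inv|[//|[f [fC pK qK cLK]]]]; last first.
    exact: (shortcut_invertible lab_inj ends_lab matchE src_lt mateP' hC uniC
      K1 fC).
  right.
  exact: (invertible_shortcut lab_inj ends_lab matchE src_lt mateP' hC uniC).
split=> _; first by left.
exact: (even_invertible lab_inj ends_lab matchE src_lt mateP' hC uniC).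
Qed.
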